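(* Let $G$ be the join $G_1\ast G_2$ of two graphs $G_1$ and $G_2$. Then $G$ is $1$-perfectly orientable if and only if one of the following holds: (1) $G_1$ is complete and $G_2$ is $1$-perfectly orientable, or $G_2$ is complete and $G_1$ is $1$-perfectly orientable; (2) each of $G_1$ and $G_2$ is a co-bipartite $1$-perfectly orientable graph. In particular, the class of co-bipartite $1$-perfectly orientable graphs is closed under join.
   Context: All graphs are finite and simple. The join $G_1\ast G_2$ is obtained from the disjoint union of $G_1$ and $G_2$ by adding all edges between a vertex of $G_1$ and a vertex of $G_2$. A graph is co-bipartite if its complement is bipartite. An orientation of a graph $G$ is $1$-perfect if for every vertex $v$, its out-neighborhood is a clique in $G$; $G$ is $1$-perfectly orientable if it admits a $1$-perfect orientation. *)

(* Defs.v *)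
From mathcomp Require Import all_boot.

Set Implicit Arguments.
Unset Strict Implicit.
Unset Printing Implicit Defensive.

(* Finite simple graphs; the graph without vertices is allowed. *)
Record sgraph := SGraph {
  vertex :> finType;
  adj : rel vertex;
  adj_sym : symmetric adj;
  adj_irrefl : irreflexive adj
}.

Arguments adj {s}.

Section Join.
Variables G1 G2 : sgraph.

Definition join_adj : rel (G1 + G2) := fun x y =>
  match x, y with
  | inl u, inl v => adj u v
  | inr u, inr v => adj u v
  | _, _ => true
  end.

Lemma join_adj_sym : symmetric join_adj.
Proof. by case=> u [] v //=; rewrite adj_sym. Qed.

Lemma join_adj_irrefl : irreflexive join_adj.
Proof. by case=> u /=; rewrite adj_irrefl. Qed.

Definition join : sgraph := SGraph join_adj_sym join_adj_irrefl.
End Join.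

Section Complement.
Variable G : sgraph.

Definition compl_adj : rel G := fun x y => (x != y) && ~~ adj x y.

Lemma compl_adj_sym : symmetric compl_adj.
Proof. by move=> x y; rewrite /compl_adj eq_sym adj_sym. Qed.

Lemma compl_adj_irrefl : irreflexive compl_adj.
Proof. by move=> x; rewrite /compl_adj eqxx. Qed.

Definition complement : sgraph := SGraph compl_adj_sym compl_adj_irrefl.
End Complement.

Definition clique (G : sgraph) (A : {set G}) : Prop :=
  {in A &, forall x y, x != y -> adj x y}.

Definition independent (G : sgraph) (A : {set G}) : Prop :=
  {in A &, forall x y, ~~ adj x y}.

Definition complete (G : sgraph) : Prop := clique [set: G].

(* One side of the bipartition may be empty. *)
Definition bipartite (G : sgraph) : Prop :=
  exists A : {set G}, independent A /\ independent (~: A).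

Definition co_bipartite (G : sgraph) : Prop := bipartite (complement G).

(* [arc x y] means that the edge xy is directed from x to y; [(+)] says that
   every edge receives exactly one of its two directions. *)
Definition orientation (G : sgraph) (arc : rel G) : Prop :=
  (forall x y, arc x y -> adj x y) /\
  (forall x y, adj x y -> arc x y (+) arc y x).

Definition out_nbh (G : sgraph) (arc : rel G) (v : G) : {set G} :=
  [set w | arc v w].

Definition one_perfect_orientation (G : sgraph) (arc : rel G) : Prop :=
  orientation arc /\ forall v : G, clique (out_nbh arc v).

Definition one_perfectly_orientable (G : sgraph) : Prop :=
  exists arc : rel G, one_perfect_orientation arc.

(* Main.v *)
(* A 1-perfect orientation of the join is the same as one of each factor plus a
   direction for every cross edge such that the cross out-neighbourhoods are
   cliques: cliques of the two factors are completely joined, so nothing else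
   has to be checked.  If [a] and [b] are non-adjacent in one factor, every
   vertex of the other one has a cross in-arc from [a] or [b], so the two cross
   out-neighbourhoods of [a] and [b] are cliques covering that factor.
   Conversely, if the factors are covered by cliques [A1], [B1] and [A2], [B2],
   directing the cross edges along the cycle A1 -> A2 -> B1 -> B2 -> A1 works. *)
Require Import Defs.
From mathcomp Require Import all_boot.

Set Implicit Arguments.
Unset Strict Implicit.
Unset Printing Implicit Defensive.

Lemma co_bipartiteP (G : sgraph) :
  co_bipartite G <-> exists A : {set G}, clique A /\ clique (~: A).
Proof.
have indepE (A : {set G}) : independent (G := complement G) A <-> clique A.
  split=> hA x y xA yA.
    by move=> xy; move: (hA x y xA yA); rewrite /= /compl_adj xy negbK.
  rewrite /= /compl_adj; case: eqVneq => //= xy.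
  by rewrite negbK; apply: hA.
by split=> -[A [/indepE ? /indepE ?]]; exists A.
Qed.

Lemma complete_or_nonedge (G : sgraph) :
  complete G \/ exists a b : G, a != b /\ ~~ adj a b.
Proof.
have [/'forall_forallP adjT|] :=
    boolP [forall x : G, forall y : G, (x != y) ==> adj x y].
  by left=> x y _ _; apply/implyP.
rewrite negb_forall => /existsP[a]; rewrite negb_forall => /existsP[b].
by rewrite negb_imply => /andP[ab nab]; right; exists a, b.
Qed.

(** Every vertex set is a clique here, so any orientation will do; [enum_rank] supplies a linear
    order. *)
Lemma complete_one_perfectly_orientable (G : sgraph) :
  complete G -> one_perfectly_orientable G.
Proof.
move=> adjT; exists (fun x y : G => enum_rank x < enum_rank y); split; last first.
  by move=> v x y _ _; apply: adjT; rewrite inE.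
split=> x y; last first.
  move=> xy; have : enum_rank x != enum_rank y.
    by apply: contraTneq xy => /enum_rank_inj ->; rewrite adj_irrefl.
  by rewrite -val_eqE /=; case: ltngtP.
move=> ltxy; apply: adjT; rewrite ?inE //.
by apply: contraTneq ltxy => ->; rewrite ltnn.
Qed.

(* [c u v] means that the cross edge uv of the join is directed from u to v. *)
Definition cross_cliques (G1 G2 : sgraph) (c : G1 -> G2 -> bool) : Prop :=
  (forall u, clique [set v | c u v]) /\ (forall v, clique [set u | ~~ c u v]).

Lemma cross_cliques_sym (G1 G2 : sgraph) (c : G1 -> G2 -> bool) :
  cross_cliques c -> cross_cliques (fun v u => ~~ c u v).
Proof.
by move=> [c1 c2]; split=> // u x y; rewrite !inE !negbK => cx cy;
  apply: (c1 u); rewrite inE.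
Qed.

Lemma cross_cliques_co_bipartite (G1 G2 : sgraph) (c : G1 -> G2 -> bool) :
  cross_cliques c -> complete G2 \/ co_bipartite G1.
Proof.
move=> [c1 c2]; have [|[a [b [ab nab]]]] := complete_or_nonedge G2; first by left.
right; apply/co_bipartiteP; exists [set u | ~~ c u a]; split=> // x y.
(* A vertex with an arc to [a] has none to the non-neighbour [b], so it receives one from [b]. *)
have cNb u : u \in ~: [set u | ~~ c u a] -> u \in [set u | ~~ c u b].
  rewrite !inE negbK => ua; apply: contra nab => ub.
  by apply: (c1 u); rewrite ?inE.
by move=> /cNb xb /cNb yb; apply: (c2 b).
Qed.

Lemma join_one_perfectly_orientableP (G1 G2 : sgraph) :
  one_perfectly_orientable (join G1 G2) <->
  [/\ one_perfectly_orientable G1, one_perfectly_orientable G2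
    & exists c : G1 -> G2 -> bool, cross_cliques c].
Proof.
split=> [[arc [[arc_adj arc_xor] arc_cl]]|].
  have cl z x y : arc z x -> arc z y -> x != y -> join_adj x y.
    by move=> zx zy; apply: (arc_cl z); rewrite inE.
  split.
  - exists (fun x y => arc (inl x) (inl y)); split.
      split=> x y; first exact: (arc_adj (inl x) (inl y)).
      exact: (arc_xor (inl x) (inl y)).
    by move=> v x y; rewrite !inE; apply: cl.
  - exists (fun x y => arc (inr x) (inr y)); split.
      split=> x y; first exact: (arc_adj (inr x) (inr y)).
      exact: (arc_xor (inr x) (inr y)).
    by move=> v x y; rewrite !inE; apply: cl.
  - have arcN u v : ~~ arc (inl u) (inr v) = arc (inr v) (inl u).
      by have := arc_xor (inl u) (inr v) isT; do 2!case: (arc _ _).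
    exists (fun u v => arc (inl u) (inr v)).
    by split=> z x y; rewrite !inE ?arcN; apply: cl.
move=> [[arc1 [[adj1 xor1] cl1]] [arc2 [[adj2 xor2] cl2]] [c [c1 c2]]].
pose arc (x y : join G1 G2) := match x, y with
  | inl u, inl v => arc1 u v
  | inr u, inr v => arc2 u v
  | inl u, inr v => c u v
  | inr v, inl u => ~~ c u v
  end.
exists arc; split; first split.
- by case=> u [] v //=; [apply: adj1 | apply: adj2].
- by case=> u [] v /=; [apply: xor1 | case: (c u v) | case: (c v u) | apply: xor2].
(* Only pairs of out-neighbours within one factor survive; mixed pairs are adjacent in the join. *)
- case=> z [] x [] y; rewrite !inE //= => zx zy xy.
  + by apply: (cl1 z); rewrite ?inE.
  + by apply: (c1 z); rewrite ?inE.
  + by apply: (c2 z); rewrite ?inE.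
  + by apply: (cl2 z); rewrite ?inE.
Qed.

(** With all cross edges directed into the complete factor, the cross out-neighbourhoods of its own
    vertices are empty. *)
Lemma complete_cross_cliques (G1 G2 : sgraph) :
  complete G2 -> cross_cliques (fun (_ : G1) (_ : G2) => true).
Proof.
move=> adjT; split=> z x y; rewrite !inE // => _ _.
by apply: adjT; rewrite inE.
Qed.

Lemma co_bipartite_cross_cliques (G1 G2 : sgraph) :
  co_bipartite G1 -> co_bipartite G2 ->
  exists c : G1 -> G2 -> bool, cross_cliques c.
Proof.
move=> /co_bipartiteP[A1 [cA1 cB1]] /co_bipartiteP[A2 [cA2 cB2]].
(* The 4-cycle of parts: each cross out-neighbourhood is exactly one of the four covering
   cliques. *)
exists (fun u v => (u \in A1) == (v \in A2)); split=> z x y; rewrite !inE.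
- case: (z \in A1) => /eqP/esym xA /eqP/esym yA; first exact: cA2.
  by apply: cB2; rewrite inE ?xA ?yA.
- case: (z \in A2); rewrite ?eqb_id ?eqbF_neg ?negbK => xA yA.
    by apply: cB1; rewrite inE.
  exact: cA1.
Qed.

(** A clique of one factor together with a clique of the other is a clique of the join, so the two
    covers merge part by part. *)
Lemma co_bipartite_join (G1 G2 : sgraph) :
  co_bipartite G1 -> co_bipartite G2 -> co_bipartite (join G1 G2).
Proof.
move=> /co_bipartiteP[A1 [cA1 cB1]] /co_bipartiteP[A2 [cA2 cB2]].
apply/co_bipartiteP.
exists [set x : join G1 G2 | match x with inl u => u \in A1 | inr v => v \in A2 end].
split=> -[] x [] y; rewrite !inE //= => xA yA xy.
- exact: cA1.
- exact: cA2.
- by apply: cB1; rewrite ?inE.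
- by apply: cB2; rewrite ?inE.
Qed.

Theorem theorem7 :
  (forall G1 G2 : sgraph,
     one_perfectly_orientable (join G1 G2) <->
     ((complete G1 /\ one_perfectly_orientable G2) \/
      (complete G2 /\ one_perfectly_orientable G1)) \/
     ((co_bipartite G1 /\ one_perfectly_orientable G1) /\
      (co_bipartite G2 /\ one_perfectly_orientable G2))) /\
  (forall G1 G2 : sgraph,
     co_bipartite G1 /\ one_perfectly_orientable G1 ->
     co_bipartite G2 /\ one_perfectly_orientable G2 ->
     co_bipartite (join G1 G2) /\ one_perfectly_orientable (join G1 G2)).
Proof.
split=> G1 G2; last first.
  move=> [b1 o1] [b2 o2]; split; first exact: co_bipartite_join.
  apply/join_one_perfectly_orientableP; split=> //.
  exact: co_bipartite_cross_cliques.
split=> [/join_one_perfectly_orientableP[o1 o2 [c cc]]|].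
  (* The dichotomy is used once from each side: if neither factor is complete, both are
     co-bipartite. *)
  have [k2|b1] := cross_cliques_co_bipartite cc; first by left; right.
  have [k1|b2] := cross_cliques_co_bipartite (cross_cliques_sym cc).
    by left; left.
  by right.
move=> H; apply/join_one_perfectly_orientableP.
case: H => [[[k1 o2]|[k2 o1]]|[[b1 o1] [b2 o2]]]; split=> //.
- exact: complete_one_perfectly_orientable.
- by eexists; apply/cross_cliques_sym/complete_cross_cliques.
- exact: complete_one_perfectly_orientable.
- by eexists; apply: complete_cross_cliques.
- exact: co_bipartite_cross_cliques.
Qed.
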